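(* Let $$u(x):=\inf_{\tau\in\mathcal{T}_0}\ln\mathbb{E}_x\Big[\exp\Big(\sum_{i=0}^{\tau-1}g(X_i)+G(X_\tau)\Big)\Big],\qquad w(x):=\inf_{\tau\in\mathcal{T}_0}\liminf_{n\to\infty}\ln\mathbb{E}_x\Big[\exp\Big(\sum_{i=0}^{\tau\wedge n-1}g(X_i)+G(X_{\tau\wedge n})\Big)\Big],\quad x\in E.$$ Then: (1) $u\equiv\underline{w}$ and $w\equiv\overline{w}$, where $\underline{w}(x)=\lim_{n\to\infty}\underline{w}_n(x)$ and $\overline{w}(x)=\lim_{n\to\infty}\overline{w}_n(x)$ are the limits of the Bellman iterates defined in the context. (2) The functions $u$ and $w$ are solutions to the Bellman equation $e^{v(x)}=Se^{v}(x)$, $x\in E$. (3) For any solution $v$ to the Bellman equation satisfying $0\le v(\cdot)\le G(\cdot)$ we have $u(\cdot)\le v(\cdot)\le w(\cdot)$.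
   Context: Setting (discrete time). $E$ is a locally compact separable metric space with its Borel $\sigma$-field; $X=(X_n)_{n\in\mathbb{N}}$, $\mathbb{N}=\{0,1,2,\dots\}$, is a time-homogeneous discrete-time Markov process with values in $E$ on a filtered measurable space $(\Omega,\mathcal{F},(\mathcal{F}_n))$; $\mathbb{P}_x$ is the probability under which $X_0=x$, with expectation $\mathbb{E}_x$. The functions $g:E\to[0,\infty)$ and $G:E\to[0,\infty)$ are measurable, $g$ is bounded and $g(\cdot)\ge c$ for some constant $c>0$, and $\mathbb{E}_x[\max_{0\le i\le n}e^{G(X_i)}]<\infty$ for all $x\in E$, $n\in\mathbb{N}$. No continuity is assumed. $\mathcal{T}_0$ is the family of $\mathbb{N}$-valued stopping times (finite $\mathbb{P}_x$-a.s. for the starting points $x$ considered), and $\sum_{i=0}^{-1}(\cdot)=0$. Bellman operator: $Sh(x):=\min\big(e^{G(x)},\,e^{g(x)}\mathbb{E}_x[h(X_1)]\big)$ for measurable $h:E\to[0,\infty)$. A solution to the Bellman equation is a measurable $v:E\to[0,\infty)$ with $e^{v(x)}=Se^{v}(x)$ for all $x\in E$. Bellman iterates: $\underline{w}_0:=0$, $\underline{w}_{n+1}:=\ln Se^{\underline{w}_n}$; $\overline{w}_0:=G$, $\overline{w}_{n+1}:=\ln Se^{\overline{w}_n}$, $n\in\mathbb{N}$. For each $x$, $(\underline{w}_n(x))$ is non-decreasing and $(\overline{w}_n(x))$ is non-increasing, so both limits exist. *)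

(* Defs.v *)
From HB Require Import structures.
From mathcomp Require Import all_boot all_order all_algebra.
From mathcomp Require Import all_classical all_reals all_analysis.
From mathcomp Require Import measurable_realfun.

Set Implicit Arguments.
Unset Strict Implicit.
Unset Printing Implicit Defensive.

Import Order.TTheory GRing.Theory Num.Theory.
Import numFieldNormedType.Exports.

Local Open Scope classical_set_scope.
Local Open Scope ring_scope.
Local Open Scope ereal_scope.

(* A metric space that also carries a sigma-algebra; the two structures are
   tied together only by [borel_space] below. *)
#[short(type="measurableMetricType")]
HB.structure Definition MeasurableMetric (d : measure_display)
    (R : numDomainType) :=
  { T of Measurable d T & Metric R T }.

Definition borel_space (R : realType) (d : measure_display)
    (E : measurableMetricType d R) : Prop :=
  (measurable : set (set E)) = <<s (@open E) >>.

Definition separable_space (T : topologicalType) : Prop :=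
  exists2 D : set T, countable D & dense D.

Definition filtration (d : measure_display) (Omega : measurableType d)
    (F : nat -> set (set Omega)) : Prop :=
  [/\ forall n, sigma_algebra [set: Omega] (F n),
      forall n, F n `<=` measurable
    & forall m n, (m <= n)%N -> F m `<=` F n].

(* The last clause is P_x(X_(n+1) \in B | F_n) = P_(X_n)(X_1 \in B), with the
   conditional probability characterized by integration over the events of
   F_n; the third one makes the right-hand side a measurable function of X_n. *)
Definition markov_process (R : realType) (d d' : measure_display)
    (E : measurableType d) (Omega : measurableType d')
    (F : nat -> set (set Omega)) (X : nat -> Omega -> E)
    (P : E -> probability Omega R) : Prop :=
  [/\ forall n (B : set E), measurable B -> F n (X n @^-1` B),
      forall x, P x [set omega | X 0%N omega = x] = 1,
      forall B : set E, measurable B ->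
        measurable_fun [set: E] (fun x => P x (X 1%N @^-1` B))
    & forall x n (A : set Omega) (B : set E), F n A -> measurable B ->
        P x (A `&` X n.+1 @^-1` B) =
        \int[P x]_(omega in A) P (X n omega) (X 1%N @^-1` B)].

(* Random times take values in N u {oo}, with oo encoded as [None]. *)
Definition stopped_by (Omega : Type) (tau : Omega -> option nat) (n : nat) :
    set Omega :=
  [set omega | if tau omega is Some k then (k <= n)%N else false].

Definition stopping_time (Omega : Type) (F : nat -> set (set Omega))
    (tau : Omega -> option nat) : Prop :=
  forall n, F n (stopped_by tau n).

(* The class T_0 seen from the starting point x: finiteness is required
   P_x-almost surely, not pointwise. *)
Definition finite_stopping_times (R : realType) (d d' : measure_display)
    (E : measurableType d) (Omega : measurableType d')
    (F : nat -> set (set Omega)) (P : E -> probability Omega R) (x : E) :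
    set (Omega -> option nat) :=
  [set tau | stopping_time F tau /\ {ae P x, forall omega, tau omega != None}].

(* tau /\ n, always finite *)
Definition truncate (Omega : Type) (tau : Omega -> option nat) (n : nat) :
    Omega -> option nat :=
  fun omega => Some (if tau omega is Some k then minn k n else n).

(* exp (\sum_(i < tau) g (X_i) + G (X_tau)); the value 0 on {tau = oo} only
   matters on a null set. *)
Definition stopped_payoff (R : realType) (E Omega : Type)
    (X : nat -> Omega -> E) (g G : E -> R) (tau : Omega -> option nat)
    (omega : Omega) : R :=
  if tau omega is Some k then
    expR (\sum_(i < k) g (X i omega) + G (X k omega))%R
  else 0%R.

Definition log_cost (R : realType) (d d' : measure_display)
    (E : measurableType d) (Omega : measurableType d')
    (X : nat -> Omega -> E) (P : E -> probability Omega R) (g G : E -> R)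
    (tau : Omega -> option nat) (x : E) : \bar R :=
  lne 'E_(P x)[stopped_payoff X g G tau].

Definition value_u (R : realType) (d d' : measure_display)
    (E : measurableType d) (Omega : measurableType d')
    (F : nat -> set (set Omega)) (X : nat -> Omega -> E)
    (P : E -> probability Omega R) (g G : E -> R) (x : E) : \bar R :=
  ereal_inf [set log_cost X P g G tau x
            | tau in finite_stopping_times F P x].

Definition value_w (R : realType) (d d' : measure_display)
    (E : measurableType d) (Omega : measurableType d')
    (F : nat -> set (set Omega)) (X : nat -> Omega -> E)
    (P : E -> probability Omega R) (g G : E -> R) (x : E) : \bar R :=
  ereal_inf [set limn_einf (fun n => log_cost X P g G (truncate tau n) x)
            | tau in finite_stopping_times F P x].

(* E_x[h(X_1)] may be +oo, but the minimum is at most exp (G x), so that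
   [fine] loses nothing when h >= 0. *)
Definition bellman_op (R : realType) (d d' : measure_display)
    (E : measurableType d) (Omega : measurableType d')
    (X : nat -> Omega -> E) (P : E -> probability Omega R) (g G : E -> R)
    (h : E -> R) (x : E) : R :=
  fine (Order.min (expR (G x))%:E
                  ((expR (g x))%:E * 'E_(P x)[h \o X 1%N])).

Definition bellman_solution (R : realType) (d d' : measure_display)
    (E : measurableType d) (Omega : measurableType d')
    (X : nat -> Omega -> E) (P : E -> probability Omega R) (g G : E -> R)
    (v : E -> R) : Prop :=
  [/\ measurable_fun [set: E] v,
      forall x, (0 <= v x)%R
    & forall x, expR (v x) = bellman_op X P g G (expR \o v) x].

Definition bellman_iterate (R : realType) (d d' : measure_display)
    (E : measurableType d) (Omega : measurableType d')
    (X : nat -> Omega -> E) (P : E -> probability Omega R) (g G : E -> R)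
    (w0 : E -> R) (n : nat) : E -> R :=
  iter n (fun w x => ln (bellman_op X P g G (expR \o w) x)) w0.

Definition w_lower (R : realType) (d d' : measure_display)
    (E : measurableType d) (Omega : measurableType d')
    (X : nat -> Omega -> E) (P : E -> probability Omega R) (g G : E -> R)
    (n : nat) : E -> R :=
  bellman_iterate X P g G (fun=> 0%R) n.

Definition w_upper (R : realType) (d d' : measure_display)
    (E : measurableType d) (Omega : measurableType d')
    (X : nat -> Omega -> E) (P : E -> probability Omega R) (g G : E -> R)
    (n : nat) : E -> R :=
  bellman_iterate X P g G G n.

(* Main.v *)
Require Import Defs.
From mathcomp Require Import all_boot all_order all_algebra.
From mathcomp Require Import all_classical all_reals all_analysis.
From mathcomp Require Import measurable_realfun.
From mathcomp Require Import ring.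

Set Implicit Arguments.
Unset Strict Implicit.
Unset Printing Implicit Defensive.

Import Order.TTheory GRing.Theory Num.Theory.
Import numFieldNormedType.Exports.

Local Open Scope classical_set_scope.
Local Open Scope ring_scope.
Local Open Scope ereal_scope.

(** Write [S] for the Bellman operator acting on [h = exp w], so that the iterates
    become [S^n 1] (from below) and [S^n e^G] (from above).  Everything rests on
    one comparison.  Fix a stopping time [tau] and let the staged payoff
    [Y_n^h] be the payoff of [tau] on [{tau < n}] and
    [exp (\sum_(i < n) g (X_i)) * h (X_n)] on [{n <= tau}]: the game is
    interrupted at date [n] and [h] is paid.  By the Markov property
    ([markov_step]), paying [S h] at date [n] costs no more in the mean than
    letting [tau] act once and paying [h] at date [n + 1]
    ([staged_payoff_step_le]), with equality when [tau] stops at date [n]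
    exactly on the contact set [{S h = e^G}] ([staged_payoff_step_eq]).  Iterating
    from date [0], [S^n h (x) <= E_x Y_n^h].

    For [h = e^G] the payoff [Y_n^h] is that of [tau /\ n]; hence [S^n e^G (x)]
    is at most the cost of every [tau /\ n], and it is attained by the bounded
    time that stops at the first [k] with [S^(n-k) e^G = e^G] at [X_k]
    ([finite_horizon_optimal]).  This identifies [w].

    For [h = 1], since [g] and [G] are nonnegative, [Y_n^1] is at most the payoff
    of [tau] wherever [tau] is finite, so the lower limit is at most [u].
    Conversely let [v] be the exponential of the lower limit.  Dominated
    convergence gives [S v = v], and for [tau] the first time with [v = e^G] all
    the [E_x Y_n^v] equal [v x] ([staged_payoff_contact]).  As [v >= 1] and
    [g >= c > 0], on [{tau = oo}] the payoff [Y_n^v] grows without bound, so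
    [tau] is finite almost surely ([contact_time_finite]); as [v >= 0], the payoff
    of [tau] costs at most [v x] ([contact_time_cost]).

    Both limits are fixed points of [S] by dominated convergence, [e^(G (X_1))]
    being integrable, and a solution between [0] and [G] is squeezed between the
    iterates because [S] is monotone.

    The Markov property speaks of events only.  It is carried to integrands by
    writing a nonnegative function as a countable series of scaled indicators
    ([harmonic_layer_series]). *)

(** * Nonnegative functions as series of indicators *)

(** The greedy expansion of [f x] in the divergent series of terms [1 / k]: a term
    is taken whenever it still fits below [f x]. *)
Fixpoint harmonic_fill (R : realType) (T : Type) (f : T -> R) (n : nat)
    (x : T) : R :=
  if n is m.+1 then
    let s := harmonic_fill f m x in
    (if s + m.+1%:R^-1 <= f x then s + m.+1%:R^-1 else s)%R
  else 0%R.

Definition harmonic_layer (R : realType) (T : Type) (f : T -> R) (n : nat) :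
    set T :=
  [set x | (harmonic_fill f n x + n.+1%:R^-1 <= f x)%R].

Section HarmonicLayers.
Context {R : realType} {T : Type}.
Variable f : T -> R.
Hypothesis f_ge0 : forall x, (0 <= f x)%R.

Lemma harmonic_fillE n x :
  harmonic_fill f n x =
  (\sum_(k < n) k.+1%:R^-1 * \1_(harmonic_layer f k) x)%R.
Proof.
elim: n => [|n IH]; first by rewrite big_ord0.
rewrite big_ord_recr /= -IH indicE.
case: ifPn => h; first by rewrite mem_set// mulr1.
by rewrite memNset ?mulr0 ?addr0//; apply/negP.
Qed.

Lemma harmonic_fill_le n x : (harmonic_fill f n x <= f x)%R.
Proof. by elim: n => [|n IH] //=; case: ifP. Qed.

Lemma harmonic_fill_homo x :
  nondecreasing_seq (fun n => harmonic_fill f n x).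
Proof.
apply/nondecreasing_seqP => n /=; case: ifP => // _.
by rewrite lerDl invr_ge0.
Qed.

(** If the greedy sums stopped short of [f x], every sufficiently small term would
    fit and be taken, so the harmonic series would converge. *)
Lemma harmonic_fill_cvg x : harmonic_fill f n x @[n --> \oo] --> f x.
Proof.
have bnd : has_ubound (range (fun n => harmonic_fill f n x)).
  by exists (f x) => _ [n _ <-]; exact: harmonic_fill_le.
have cv := nondecreasing_is_cvgn (harmonic_fill_homo x) bnd.
have limle : (limn (fun n => harmonic_fill f n x) <= f x)%R.
  by apply: limr_le => //; near=> n; exact: harmonic_fill_le.
suff -> : f x = limn (fun n => harmonic_fill f n x) by [].
apply/eqP; rewrite eq_le limle andbT leNgt; apply/negP => lt.
set L := limn _ in lt limle.
have [N _ HN] : \forall n \near \oo, (n.+1%:R^-1 < f x - L :> R)%R.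
  have /cvgrPdist_lt/(_ (f x - L)%R) := @cvg_harmonic R.
  rewrite subr_gt0 => /(_ lt); apply: filterS => n /=.
  by rewrite sub0r normrN ger0_norm.
have fillL n : (harmonic_fill f n x <= L)%R.
  exact: (nondecreasing_cvgn_le (harmonic_fill_homo x) cv).
have fillS n : (N <= n)%N ->
    harmonic_fill f n.+1 x = (harmonic_fill f n x + n.+1%:R^-1)%R.
  move=> /HN /= small; rewrite ifT//.
  rewrite ltrBrDl in small; apply/ltW/(le_lt_trans _ small).
  by rewrite lerD2r; exact: fillL.
apply: (@dvg_harmonic R).
apply: nondecreasing_is_cvgn.
  by apply: nondecreasing_series => n _ _ /=; rewrite invr_ge0.
have key k : series harmonic (N + k)%N =
    (harmonic_fill f (N + k) x - harmonic_fill f N x + series harmonic N)%R.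
  elim: k => [|k IH]; first by rewrite addn0; ring.
  rewrite addnS fillS ?leq_addr// seriesSr IH /=; ring.
exists (L - harmonic_fill f N x + series harmonic N)%R => _ [n _ <-].
apply: (@le_trans _ _ (series harmonic (N + n)%N)).
  by apply: nondecreasing_series => [m _ _ /=|]; rewrite ?invr_ge0 ?leq_addl.
by rewrite key lerD2r lerD2r.
Unshelve. all: by end_near. Qed.

(** A single series with constant coefficients and measurable sets replaces the
    usual passage through simple functions and monotone limits. *)
Lemma harmonic_layer_series x :
  (f x)%:E = \sum_(k <oo) (k.+1%:R^-1)%:E * (\1_(harmonic_layer f k) x)%:E.
Proof.
apply/esym/cvg_lim => //.
under eq_fun => n.
  rewrite big_mkord (eq_bigr (fun k : 'I_n =>
    (k.+1%:R^-1 * \1_(harmonic_layer f k) x)%:E)); last first.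
    by move=> k _; rewrite EFinM.
  rewrite sumEFin -harmonic_fillE.
  over.
by apply/cvg_EFin; [near=> n|exact: harmonic_fill_cvg].
Unshelve. all: by end_near. Qed.

End HarmonicLayers.

Section MeasurableHarmonicLayers.
Context {R : realType} {d : measure_display} {T : measurableType d}.
Variable f : T -> R.

Lemma measurable_harmonic_fill n : measurable_fun [set: T] f ->
  measurable_fun [set: T] (harmonic_fill f n).
Proof.
move=> mf; elim: n => [|n IH] /=; first exact: measurable_cst.
apply: measurable_fun_ifT => //.
  by apply: measurable_fun_ler => //; exact: measurable_funD.
exact: measurable_funD.
Qed.

Lemma measurable_harmonic_layer n : measurable_fun [set: T] f ->
  measurable (harmonic_layer f n).
Proof.
move=> mf; rewrite -[X in measurable X]setTI; apply: measurable_fun_le => //.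
by apply: measurable_funD => //; exact: measurable_harmonic_fill.
Qed.

End MeasurableHarmonicLayers.

(** Measurability is asked of the layers only, not of [f]: this lets [f] be
    measurable for a smaller sigma-algebra than the one carrying [mu]. *)
Lemma integral_mul_layers (R : realType) (d : measure_display)
    (T : measurableType d) (S : Type) (mu : measure T R) (D : set T)
    (phi : T -> S) (f : S -> R) (k : T -> \bar R) :
  measurable D -> (forall y, (0 <= f y)%R) ->
  (forall n, measurable (phi @^-1` harmonic_layer f n)) ->
  measurable_fun D k -> (forall x, 0 <= k x < +oo) ->
  \int[mu]_(x in D) ((f (phi x))%:E * k x) =
  \sum_(n <oo) (n.+1%:R^-1)%:E *
    \int[mu]_(x in D `&` phi @^-1` harmonic_layer f n) k x.
Proof.
move=> mD f0 mf mk kfin.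
have k0 x : 0 <= k x by have /andP[] := kfin x.
pose term n x := (n.+1%:R^-1)%:E * (k \_ (phi @^-1` harmonic_layer f n)) x.
have term_ge0 n x : 0 <= (k \_ (phi @^-1` harmonic_layer f n)) x.
  by rewrite /patch; case: ifP.
have mterm n : measurable_fun D (k \_ (phi @^-1` harmonic_layer f n)).
  apply/measurable_restrict => //.
  by apply: measurable_funS mk => //; exact: subIsetl.
under eq_integral => x _.
  have -> : (f (phi x))%:E * k x = \sum_(n <oo) term n x.
    have /fineK kE : k x \is a fin_num.
      by rewrite ge0_fin_numE//; have /andP[] := kfin x.
    rewrite (harmonic_layer_series f0) muleC -kE -nneseriesZl; last first.
      by move=> n _; rewrite mule_ge0// lee_fin// indicE.
    apply: eq_eseriesr => n _; rewrite kE /term epatch_indic /= muleCA.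
    by rewrite !indicE.
  over.
rewrite integral_nneseries//; last 2 first.
- by move=> n; apply: measurable_funeM.
- by move=> n x _; rewrite mule_ge0 ?lee_fin.
apply: eq_eseriesr => n _.
by rewrite ge0_integralZl_EFin// -integral_mkcondr.
Qed.

Lemma integral_comp_layers (R : realType) (d : measure_display)
    (T : measurableType d) (S : Type) (mu : measure T R) (D : set T)
    (phi : T -> S) (f : S -> R) :
  measurable D -> (forall y, (0 <= f y)%R) ->
  (forall n, measurable (phi @^-1` harmonic_layer f n)) ->
  \int[mu]_(x in D) (f (phi x))%:E =
  \sum_(n <oo) (n.+1%:R^-1)%:E * mu (D `&` phi @^-1` harmonic_layer f n).
Proof.
move=> mD f0 mf.
under eq_integral do rewrite -[(f _)%:E]mule1.
rewrite integral_mul_layers//; last by move=> x; rewrite lee01 ltry.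
apply: eq_eseriesr => n _.
by rewrite integral_cst ?mul1e//; exact: measurableI.
Qed.

Lemma limn_einf_ge (R : realType) (u : nat -> \bar R) l : (forall n, l <= u n) ->
  l <= limn_einf u.
Proof.
move=> lu; rewrite limn_einf_lim; apply: lime_ge; first exact: is_cvg_einfs.
by near=> n; apply/ereal_infP => _ [m _ <-].
Unshelve. all: by end_near. Qed.

Lemma expectationE (R : realType) (d : measure_display)
    (T : measurableType d) (P : probability T R) (X : T -> R) :
  'E_P[X] = \int[P]_x (X x)%:E.
Proof. by rewrite unlock. Qed.

(** * The Markov property for functions *)

Section MarkovStep.
Context {R : realType} {d d' : measure_display}.
Context {E : measurableType d} {Omega : measurableType d'}.
Context {F : nat -> set (set Omega)} {X : nat -> Omega -> E}.
Context {P : E -> probability Omega R}.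
Hypothesis F_filtration : filtration F.
Hypothesis X_markov : markov_process F X P.

Lemma filtration_measurable n A : F n A -> measurable A.
Proof. by have [_ + _] := F_filtration; exact. Qed.

(** Measurability with respect to [F n] is expressed by giving [Omega] the
    sigma-algebra generated by [F n], so that the measurability lemmas for
    functions apply to it. *)
Lemma filtrationP n A :
  measurable (A : set (g_sigma_algebraType (F n))) <-> F n A.
Proof.
have [sF _ _] := F_filtration.
by rewrite /measurable/= sigma_algebra_id.
Qed.

Lemma process_preimage i n B : (i <= n)%N -> measurable B -> F n (X i @^-1` B).
Proof.
move=> le_in mB; have [_ _ mono] := F_filtration.
by apply: (mono _ _ le_in); have [+ _ _ _] := X_markov; exact.
Qed.

Lemma process_adapted i n : (i <= n)%N ->
  measurable_fun [set: g_sigma_algebraType (F n)]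
    (X i : g_sigma_algebraType (F n) -> E).
Proof.
move=> le_in _ B mB; rewrite setTI; apply/filtrationP.
exact: process_preimage.
Qed.

Lemma process_measurable i : measurable_fun [set: Omega] (X i).
Proof.
move=> _ B mB; rewrite setTI; apply: (@filtration_measurable i).
exact: process_preimage.
Qed.

Lemma step_series (h : E -> R) y : measurable_fun [set: E] h ->
  (forall y, (0 <= h y)%R) ->
  'E_(P y)[h \o X 1%N] =
  \sum_(n <oo) (n.+1%:R^-1)%:E * P y (X 1%N @^-1` harmonic_layer h n).
Proof.
move=> mh h0.
rewrite expectationE (@integral_comp_layers _ _ _ _ _ _ (X 1%N) h)//.
  by apply: eq_eseriesr => n _; rewrite setTI.
move=> n; rewrite -[X in measurable X]setTI; apply: process_measurable => //.
exact: measurable_harmonic_layer.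
Qed.

Lemma measurable_step_mean (h : E -> R) : measurable_fun [set: E] h ->
  (forall y, (0 <= h y)%R) ->
  measurable_fun [set: E] (fun y => 'E_(P y)[h \o X 1%N]).
Proof.
move=> mh h0; under eq_fun do rewrite step_series//.
apply: ge0_emeasurable_sum => k.
  by move=> x _ _; rewrite mule_ge0 ?lee_fin.
move=> _; apply: measurable_funeM.
have [_ _ mP1 _] := X_markov.
by apply: mP1; exact: measurable_harmonic_layer.
Qed.

(** Both sides expand over the layers of [h], and the Markov property matches the
    two series term by term. *)
Lemma markov_step_event x n (A : set Omega) (h : E -> R) : F n A ->
  measurable_fun [set: E] h -> (forall y, (0 <= h y)%R) ->
  \int[P x]_(omega in A) (h (X n.+1 omega))%:E =
  \int[P x]_(omega in A) 'E_(P (X n omega))[h \o X 1%N].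
Proof.
move=> FA mh h0; have mA := filtration_measurable FA.
have ml k : measurable (harmonic_layer h k) by exact: measurable_harmonic_layer.
have [_ _ mP1 step] := X_markov.
under [RHS]eq_integral do rewrite step_series//.
rewrite (@integral_comp_layers _ _ _ _ _ _ (X n.+1) h)//; last first.
  move=> k; apply: (@filtration_measurable n.+1); exact: process_preimage.
have mP k : measurable_fun A
    (fun omega => P (X n omega) (X 1%N @^-1` harmonic_layer h k)).
  apply: measurable_funTS.
  exact: (measurableT_comp (mP1 _ (ml k)) (process_measurable n)).
rewrite integral_nneseries//; last 2 first.
- by move=> k; apply: measurable_funeM.
- by move=> k w _; rewrite mule_ge0 ?lee_fin.
apply: eq_eseriesr => k _; rewrite ge0_integralZl_EFin//.
by congr (_ * _); exact: step.
Qed.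

(** The layers of an [F n]-measurable factor [Z] are events of [F n], so expanding
    [Z] reduces the identity to [markov_step_event] on the sets
    [A `&` harmonic_layer Z k]. *)
Lemma markov_step x n (A : set Omega) (Z : Omega -> R) (h : E -> R) :
  F n A -> (forall omega, (0 <= Z omega)%R) ->
  measurable_fun [set: g_sigma_algebraType (F n)]
    (Z : g_sigma_algebraType (F n) -> R) ->
  measurable_fun [set: E] h -> (forall y, (0 <= h y)%R) ->
  (forall y, 'E_(P y)[h \o X 1%N] < +oo) ->
  \int[P x]_(omega in A) ((Z omega)%:E * (h (X n.+1 omega))%:E) =
  \int[P x]_(omega in A) ((Z omega)%:E * 'E_(P (X n omega))[h \o X 1%N]).
Proof.
move=> FA Z0 mZ mh h0 hfin; have mA := filtration_measurable FA.
have FZ k : F n (harmonic_layer Z k).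
  by apply/filtrationP; exact: (measurable_harmonic_layer _ mZ).
have mlZ k : measurable (id @^-1` harmonic_layer Z k).
  exact: filtration_measurable (FZ k).
rewrite (@integral_mul_layers _ _ _ _ _ _ id Z)//; last 2 first.
- apply/measurable_EFinP/measurable_funTS/measurableT_comp => //.
  exact: process_measurable.
- by move=> w; rewrite lee_fin h0 ltry.
rewrite (@integral_mul_layers _ _ _ _ _ _ id Z)//; last 2 first.
- apply: measurable_funTS.
  exact: (measurableT_comp (measurable_step_mean mh h0) (process_measurable n)).
- move=> w; rewrite hfin andbT expectationE.
  by apply: integral_ge0 => w' _; rewrite lee_fin; exact: h0.
apply: eq_eseriesr => k _; rewrite (@markov_step_event _ n)//.
apply/filtrationP; apply: measurableI; apply/filtrationP; [exact: FA|exact: FZ].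
Qed.

End MarkovStep.

(** * Payoffs of interrupted games *)

Definition stopped_before (Omega : Type) (tau : Omega -> option nat) (n : nat)
    (omega : Omega) : bool :=
  if tau omega is Some k then (k < n)%N else false.

(** Interpolates between [h (X_0)] at [n = 0] and the payoff of [tau] for large [n];
    each date passed is weighed against one application of the operator. *)
Definition staged_payoff (R : realType) (E Omega : Type)
    (X : nat -> Omega -> E) (g G : E -> R) (tau : Omega -> option nat)
    (n : nat) (h : E -> R) (omega : Omega) : R :=
  if stopped_before tau n omega then stopped_payoff X g G tau omega
  else (expR (\sum_(i < n) g (X i omega)) * h (X n omega))%R.

(** Paths on which [tau] stopped before date [n] are left unconstrained, so that a
    different region can be prescribed to the same [tau] at every date. *)
Definition stops_in (E Omega : Type) (X : nat -> Omega -> E)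
    (tau : Omega -> option nat) (D : set E) (n : nat) : Prop :=
  forall w, (tau w = Some n -> D (X n w)) /\
            (~ stopped_by tau n w -> ~ D (X n w)).

Definition first_hit (E Omega : Type) (X : nat -> Omega -> E)
    (D : nat -> E -> bool) (w : Omega) : option nat :=
  if pselect (exists n, D n (X n w)) is left hit then Some (ex_minn hit)
  else None.

(** * The Bellman operator *)

(** The order interval between [1] and [e^G] is preserved by the operator and
    contains both starting points of the iteration; its elements have finite
    means after one step as soon as [e^G] does. *)
Definition admissible (R : realType) (d : measure_display)
    (E : measurableType d) (G h : E -> R) : Prop :=
  measurable_fun [set: E] h /\ forall x, (1 <= h x <= expR (G x))%R.

Section Bellman.
Context {R : realType} {d d' : measure_display}.
Context {E : measurableType d} {Omega : measurableType d'}.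
Context {F : nat -> set (set Omega)} {X : nat -> Omega -> E}.
Context {P : E -> probability Omega R} {g G : E -> R}.
Hypothesis F_filtration : filtration F.
Hypothesis X_markov : markov_process F X P.
Hypothesis g_meas : measurable_fun [set: E] g.
Hypothesis G_meas : measurable_fun [set: E] G.
Hypothesis g_ge0 : forall x, (0 <= g x)%R.
Hypothesis G_ge0 : forall x, (0 <= G x)%R.
Hypothesis expG_integrable :
  forall x, 'E_(P x)[(expR \o G) \o X 1%N] < +oo.

Local Notation S := (bellman_op X P g G).
Local Notation mean h x := ('E_(P x)[h \o X 1%N]).

Let mX := process_measurable F_filtration X_markov.

Lemma admissible_ge0 h x : admissible G h -> (0 <= h x)%R.
Proof. by move=> [_ /(_ x)/andP[h1 _]]; exact: le_trans h1. Qed.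

Lemma admissible_one : admissible G (fun=> 1%R).
Proof. by split=> [|x]; rewrite ?lexx -?[leLHS]expR0 ?ler_expR ?G_ge0. Qed.

Lemma admissible_expG : admissible G (expR \o G).
Proof.
split; first exact: measurableT_comp.
by move=> x; rewrite lexx andbT -[leLHS]expR0 ler_expR G_ge0.
Qed.

Lemma measurable_next (h : E -> R) i : measurable_fun [set: E] h ->
  measurable_fun [set: Omega] (fun w => (h (X i w))%:E).
Proof.
move=> mh; apply/measurable_EFinP.
exact: (measurableT_comp mh (mX i)).
Qed.

Lemma mean_le h k x : admissible G h -> admissible G k ->
  (forall y, (h y <= k y)%R) -> mean h x <= mean k x.
Proof.
move=> Ah Ak hk; rewrite !expectationE; apply: ge0_le_integral => //.
- by move=> w _; rewrite lee_fin; exact: (admissible_ge0 _ Ah).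
- by apply: measurable_next; case: Ah.
- by apply: measurable_next; case: Ak.
- by move=> w _; rewrite lee_fin; exact: hk.
Qed.

Lemma mean_fin h x : admissible G h -> mean h x < +oo.
Proof.
move=> Ah; apply: le_lt_trans (expG_integrable x).
apply: mean_le => // [|y]; first exact: admissible_expG.
by case: Ah => _ /(_ y)/andP[].
Qed.

Lemma mean_ge1 h x : admissible G h -> 1 <= mean h x.
Proof.
move=> Ah; apply: (@le_trans _ _ (mean (fun=> 1%R) x)).
  rewrite expectationE /=.
  by rewrite integral_cst// mul1e -(probability_setT (P x)).
apply: mean_le => // [|y]; first exact: admissible_one.
by case: Ah => _ /(_ y)/andP[].
Qed.

Lemma bellman_opE h x : admissible G h ->
  (S h x)%:E = Order.min (expR (G x))%:E ((expR (g x))%:E * mean h x).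
Proof.
move=> Ah; rewrite fineK// ge0_fin_numE.
  by rewrite gt_min ltry.
rewrite le_min lee_fin expR_ge0 mule_ge0 ?lee_fin ?expR_ge0//.
exact: le_trans (mean_ge1 x Ah).
Qed.

Lemma bellman_op_le h x : admissible G h ->
  (S h x)%:E <= (expR (g x))%:E * mean h x.
Proof. by move=> Ah; rewrite bellman_opE// ge_min lexx orbT. Qed.

Lemma bellman_op_leG h x : admissible G h -> (S h x <= expR (G x))%R.
Proof. by move=> Ah; rewrite -lee_fin bellman_opE// ge_min lexx. Qed.

Lemma bellman_op_ltG h x : admissible G h -> (S h x < expR (G x))%R ->
  (S h x)%:E = (expR (g x))%:E * mean h x.
Proof.
move=> Ah; rewrite -lte_fin bellman_opE// => lt.
by move: lt; rewrite minElt; case: ifP => //; rewrite ltxx.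
Qed.

Lemma admissible_bellman h : admissible G h -> admissible G (S h).
Proof.
move=> Ah; split.
  apply: (measurableT_comp (@fine_measurable R setT measurableT)).
  apply: measurable_mine.
    by apply/measurable_EFinP; exact: measurableT_comp.
  apply: emeasurable_funM.
    by apply/measurable_EFinP; exact: measurableT_comp.
  apply: (measurable_step_mean F_filtration X_markov).
    by case: Ah.
  by move=> y; exact: admissible_ge0.
move=> x; rewrite bellman_op_leG// andbT -lee_fin bellman_opE// le_min lee_fin.
rewrite -{1}expR0 ler_expR G_ge0/= -[leLHS]mule1.
apply: lee_pmul => //; last exact: mean_ge1.
by rewrite lee_fin -[leLHS]expR0 ler_expR.
Qed.

Lemma bellman_op_homo h k x : admissible G h -> admissible G k ->
  (forall y, (h y <= k y)%R) -> (S h x <= S k x)%R.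
Proof.
move=> Ah Ak hk; rewrite -lee_fin !bellman_opE//.
apply: le_min2 => //; apply: lee_pmul => //.
- exact: le_trans (mean_ge1 x Ah).
- exact: mean_le.
Qed.

(** The means converge by dominated convergence under [e^(G (X_1))]; being finite,
    they can be handled as reals, where the minimum is continuous. *)
Lemma bellman_op_cvg (hs : nat -> E -> R) h x :
  (forall n, admissible G (hs n)) -> admissible G h ->
  (forall y, hs n y @[n --> \oo] --> h y) ->
  S (hs n) x @[n --> \oo] --> S h x.
Proof.
move=> Ahs Ah hsh.
have finE k : admissible G k -> mean k x \is a fin_num.
  move=> Ak; rewrite ge0_fin_numE ?mean_fin//.
  exact: le_trans (mean_ge1 x Ak).
have SE k : admissible G k ->
    S k x = Order.min (expR (G x)) (expR (g x) * fine (mean k x))%R.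
  move=> Ak; apply/EFin_inj; rewrite bellman_opE// EFin_min EFinM fineK//.
  exact: finE.
under eq_fun do rewrite SE//.
rewrite SE//.
have cvgE : fine (mean (hs n) x) @[n --> \oo] --> fine (mean h x).
  apply: fine_cvg; rewrite fineK ?finE//.
  under eq_fun do rewrite expectationE.
  rewrite expectationE.
  apply: (@dominated_cvg _ _ _ _ _ _ _ _
    (fun w => (expR (G (X 1%N w)))%:E)) => //.
  - by move=> n; apply: measurable_next; case: (Ahs n).
  - by move=> w _; apply/cvg_EFin; [near=> n|exact: hsh].
  - apply/integrableP; split.
      by apply: (@measurable_next (expR \o G)); exact: measurableT_comp.
    under eq_integral do rewrite gee0_abs ?lee_fin ?expR_ge0//.
    by have := expG_integrable x; rewrite expectationE.
  - move=> n w _; rewrite gee0_abs ?lee_fin; last first.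
      exact: (admissible_ge0 _ (Ahs n)).
    by case: (Ahs n) => _ /(_ (X 1%N w))/andP[].
under eq_fun do rewrite minr_absE.
rewrite minr_absE; apply: cvgM; last exact: cvg_cst.
have cvg_next : (expR (g x) * fine (mean (hs n) x))%R @[n --> \oo] -->
    (expR (g x) * fine (mean h x))%R by apply: cvgM => //; exact: cvg_cst.
apply: cvgB; first by apply: cvgD => //; exact: cvg_cst.
by apply: cvg_norm; apply: cvgB => //; exact: cvg_cst.
Unshelve. all: by end_near. Qed.

Lemma admissible_iter n h : admissible G h -> admissible G (iter n S h).
Proof. by move=> Ah; elim: n => //= n; exact: admissible_bellman. Qed.

(** * The one-step comparison for staged payoffs *)

Local Notation staged := (staged_payoff X g G).

Lemma stopped_beforeP (tau : Omega -> option nat) n omega :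
  stopped_by tau n omega <-> stopped_before tau n.+1 omega.
Proof. by rewrite /stopped_by /stopped_before /=; case: (tau omega). Qed.

(** On [{tau <= n}] the payoff of [tau] is that of the game interrupted at date
    [n] with reward [e^G], the case [tau = n] included; this is the recursion
    behind measurability and the one-step comparison. *)
Lemma staged_payoffS (tau : Omega -> option nat) n h omega :
  staged tau n.+1 h omega =
  if stopped_before tau n.+1 omega then staged tau n (expR \o G) omega
  else (expR (\sum_(i < n.+1) g (X i omega)) * h (X n.+1 omega))%R.
Proof.
rewrite /staged_payoff /stopped_before /stopped_payoff.
case: (tau omega) => [k|]//; case: ifPn => // lt_kSn; case: ifPn => //.
rewrite -leqNgt => le_nk.
have -> : k = n by apply/eqP; rewrite eqn_leq le_nk andbT.
by rewrite expRD.
Qed.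

Lemma measurable_stopped_before (tau : Omega -> option nat) n :
  stopping_time F tau ->
  measurable_fun [set: Omega] (stopped_before tau n).
Proof.
case: n => [|n] tauF.
  rewrite (_ : stopped_before tau 0 = cst false); first exact: measurable_cst.
  by apply/funext => w; rewrite /stopped_before; case: (tau w).
apply: (measurable_fun_bool true); rewrite setTI.
apply: (filtration_measurable F_filtration (n := n)).
rewrite (_ : _ @^-1` _ = stopped_by tau n); first exact: tauF.
by apply/seteqP; split => w; rewrite /preimage /= => /stopped_beforeP.
Qed.

Lemma measurable_running_factor n :
  measurable_fun [set: Omega] (fun w => expR (\sum_(i < n) g (X i w))).
Proof.
apply: measurableT_comp => //; apply: measurable_sum => k.
exact: (measurableT_comp g_meas (mX k)).
Qed.

(** The factor accumulated before date [n + 1] is known at date [n]. *)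
Lemma adapted_running_factor n :
  measurable_fun [set: g_sigma_algebraType (F n)]
    (fun w : g_sigma_algebraType (F n) => expR (\sum_(i < n.+1) g (X i w))).
Proof.
apply: measurableT_comp => //; apply: measurable_sum => k.
apply: (measurableT_comp g_meas).
by apply: (process_adapted F_filtration X_markov); rewrite -ltnS.
Qed.

Lemma measurable_staged_payoff (tau : Omega -> option nat) n h :
  stopping_time F tau -> measurable_fun [set: E] h ->
  measurable_fun [set: Omega] (staged tau n h).
Proof.
move=> tauF mh.
have mfin k h' : measurable_fun [set: E] h' -> measurable_fun [set: Omega]
    (fun w => expR (\sum_(i < k) g (X i w)) * h' (X k w))%R.
  move=> mh'; apply: measurable_funM; first exact: measurable_running_factor.
  exact: (measurableT_comp mh' (mX k)).
elim: n h mh => [|n IH] h mh.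
  rewrite (_ : staged _ _ _ =
    fun w => expR (\sum_(i < 0) g (X i w)) * h (X 0%N w))%R; first exact: mfin.
  apply/funext => w; rewrite /staged_payoff /stopped_before.
  by case: (tau w).
rewrite (funext (staged_payoffS tau n h)).
apply: measurable_fun_ifT.
- exact: measurable_stopped_before.
- by apply: IH; exact: measurableT_comp.
- exact: mfin.
Qed.

Lemma staged_payoff_ge0 (tau : Omega -> option nat) n h omega :
  (forall y, (0 <= h y)%R) -> (0 <= staged tau n h omega)%R.
Proof.
move=> h0; rewrite /staged_payoff /stopped_payoff; case: ifP => _.
  by case: (tau omega) => [k|]//; exact: expR_ge0.
by rewrite mulr_ge0 ?expR_ge0.
Qed.

Lemma expectation_split (x : E) (A : set Omega) (f : Omega -> R) :
  measurable A -> measurable_fun [set: Omega] f ->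
  (forall w, (0 <= f w)%R) ->
  'E_(P x)[f] = \int[P x]_(w in A) (f w)%:E + \int[P x]_(w in ~` A) (f w)%:E.
Proof.
move=> mA mf f0; rewrite expectationE -ge0_integral_setU//.
- by rewrite setUv.
- exact: measurableC.
- by rewrite setUv; apply/measurable_EFinP.
- by move=> w _; rewrite lee_fin.
- by apply/disj_setPCl.
Qed.

(** This and [staged_payoff_next] split two consecutive stages along the same
    event [{tau <= n}] of [F n], so that they can be compared piece by piece. *)
Lemma staged_payoff_now (tau : Omega -> option nat) n h x :
  stopping_time F tau -> admissible G h ->
  'E_(P x)[staged tau n h] =
  \int[P x]_(w in stopped_by tau n) (staged tau n h w)%:E +
  \int[P x]_(w in ~` stopped_by tau n)
    ((expR (\sum_(i < n) g (X i w)))%:E * (h (X n w))%:E).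
Proof.
move=> tauF [mh h1]; have mA := filtration_measurable F_filtration (tauF n).
rewrite (expectation_split _ mA).
- congr (_ + _); apply: eq_integral => w.
  rewrite inE => /stopped_beforeP/negP nst.
  rewrite /staged_payoff ifN ?EFinM//; apply: contra nst.
  by rewrite /stopped_before; case: (tau w) => // k /ltnW.
- exact: measurable_staged_payoff.
- move=> w; apply: staged_payoff_ge0 => y.
  by have /andP[+ _] := h1 y; apply: le_trans.
Qed.

(** The decision to continue past [n] and the factor accumulated up to [X_n] are
    both known at date [n], so the Markov property averages [h (X_n.+1)]. *)
Lemma staged_payoff_next (tau : Omega -> option nat) n h x :
  stopping_time F tau -> admissible G h ->
  'E_(P x)[staged tau n.+1 h] =
  \int[P x]_(w in stopped_by tau n) (staged tau n (expR \o G) w)%:E +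
  \int[P x]_(w in ~` stopped_by tau n)
    ((expR (\sum_(i < n) g (X i w)))%:E *
     ((expR (g (X n w)))%:E * mean h (X n w))).
Proof.
move=> tauF Ah; have [mh h1] := Ah.
have mA := filtration_measurable F_filtration (tauF n).
have FA : F n (~` stopped_by tau n).
  apply/(filtrationP F_filtration); apply: measurableC.
  exact/(filtrationP F_filtration).
rewrite (expectation_split _ mA); last 2 first.
- exact: measurable_staged_payoff.
- by move=> w; apply: staged_payoff_ge0 => y; exact: admissible_ge0 Ah.
congr (_ + _).
  apply: eq_integral => w; rewrite inE => /stopped_beforeP st.
  by rewrite staged_payoffS st.
under eq_integral => w.
  rewrite inE => /stopped_beforeP/negP/negPf nst.
  rewrite staged_payoffS nst EFinM; over.
rewrite (markov_step F_filtration X_markov x FA _ (@adapted_running_factor n))//.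
- apply: eq_integral => w _.
  by rewrite muleA -EFinM -expRD big_ord_recr.
- by move=> y; exact: admissible_ge0 Ah.
- by move=> y; exact: mean_fin.
Qed.

(** [S h] is at most [e^G], which is paid where [tau = n], and at most
    [e^g * E h(X_1)], which is the mean of what is paid where [tau] goes on. *)
Lemma staged_payoff_step_le (tau : Omega -> option nat) n h x :
  stopping_time F tau -> admissible G h ->
  'E_(P x)[staged tau n (S h)] <= 'E_(P x)[staged tau n.+1 h].
Proof.
move=> tauF Ah; have ASh := admissible_bellman Ah.
have mA := filtration_measurable F_filtration (tauF n).
have mfactor : measurable_fun [set: Omega]
    (fun w => (expR (\sum_(i < n) g (X i w)))%:E).
  by apply/measurable_EFinP; exact: measurable_running_factor.
rewrite staged_payoff_now// staged_payoff_next//; apply: leeD.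
- apply: ge0_le_integral => //.
  + move=> w _; rewrite lee_fin; apply: staged_payoff_ge0 => y.
    exact: admissible_ge0 ASh.
  + apply/measurable_EFinP/measurable_funTS.
    by apply: measurable_staged_payoff => //; case: ASh.
  + apply/measurable_EFinP/measurable_funTS.
    by apply: measurable_staged_payoff => //; case: admissible_expG.
  + move=> w _; rewrite lee_fin /staged_payoff; case: ifP => // _.
    by rewrite ler_wpM2l ?expR_ge0// bellman_op_leG.
- apply: ge0_le_integral => //.
  + exact: measurableC.
  + by move=> w _; rewrite mule_ge0 ?lee_fin ?expR_ge0// (admissible_ge0 _ ASh).
  + apply/measurable_funTS/emeasurable_funM => //.
    by apply: measurable_next; case: ASh.
  + apply/measurable_funTS/emeasurable_funM => //; apply: emeasurable_funM.
      by apply: (@measurable_next (expR \o g)); exact: measurableT_comp.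
    have [mh _] := Ah; have h0 y := admissible_ge0 y Ah.
    exact: (measurableT_comp
      (measurable_step_mean F_filtration X_markov mh h0) (mX n)).
  + move=> w _; apply: lee_pmul => //.
      by rewrite lee_fin (admissible_ge0 _ ASh).
    exact: bellman_op_le.
Qed.

(** Off the contact set the minimum defining [S h] is its second term, so no loss
    occurs in either piece. *)
Lemma staged_payoff_step_eq (tau : Omega -> option nat) n h x :
  stopping_time F tau -> admissible G h ->
  stops_in X tau [set y | S h y = expR (G y)] n ->
  'E_(P x)[staged tau n (S h)] = 'E_(P x)[staged tau n.+1 h].
Proof.
move=> tauF Ah opt; have ASh := admissible_bellman Ah.
rewrite staged_payoff_now// staged_payoff_next//; congr (_ + _).
- apply: eq_integral => w.
  rewrite inE /stopped_by /staged_payoff /stopped_before /=.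
  case: (opt w) => + _; case: (tau w) => // k stop le_kn; case: ltnP => // le_nk.
  by rewrite stop//; congr Some; apply/eqP; rewrite eqn_leq le_kn.
- apply: eq_integral => w; rewrite inE => /= nst; congr (_ * _).
  apply: bellman_op_ltG => //.
  rewrite lt_neqAle bellman_op_leG// andbT; apply/eqP.
  by case: (opt w) => _; apply.
Qed.

Lemma staged_payoff_iter_le (tau : Omega -> option nat) k n h x :
  stopping_time F tau -> admissible G h ->
  'E_(P x)[staged tau k (iter n S h)] <= 'E_(P x)[staged tau (k + n) h].
Proof.
move=> tauF Ah; elim: n k => [|n IH] k; first by rewrite addn0.
rewrite addnS -addSn; apply: le_trans (IH k.+1).
exact: staged_payoff_step_le (admissible_iter n Ah).
Qed.

(** With [n] steps to go from date [k], [n - m] of them remain at date [k + m],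
    and the contact set is that of the corresponding iterate. *)
Lemma staged_payoff_iter_eq (tau : Omega -> option nat) k n h x :
  stopping_time F tau -> admissible G h ->
  (forall m, (m < n)%N ->
    stops_in X tau [set y | iter (n - m) S h y = expR (G y)] (k + m)) ->
  'E_(P x)[staged tau k (iter n S h)] = 'E_(P x)[staged tau (k + n) h].
Proof.
move=> tauF Ah; elim: n k => [|n IH] k opt; first by rewrite addn0.
rewrite addnS -addSn -IH; last first.
  move=> m lt_mn; rewrite addSn -addnS -[(n - m)%N]/(n.+1 - m.+1)%N.
  exact: opt.
rewrite iterS; apply: staged_payoff_step_eq => //; first exact: admissible_iter.
by have := opt 0%N; rewrite subn0 addn0; exact.
Qed.

(** The staged payoffs with reward [0] increase to the payoff of [tau], also where
    [tau] is infinite: there both are [0]. *)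
Lemma staged_payoff_cvg (tau : Omega -> option nat) w :
  staged tau n (fun=> 0%R) w @[n --> \oo] --> stopped_payoff X g G tau w.
Proof.
apply: cvg_near_cst; rewrite /staged_payoff /stopped_payoff /stopped_before.
case: (tau w) => [k|]; last by near=> n; rewrite mulr0.
by exists k.+1 => // n /= ->.
Unshelve. all: by end_near. Qed.

Lemma staged_payoff_homo (tau : Omega -> option nat) w :
  nondecreasing_seq (fun n => staged tau n (fun=> 0%R) w).
Proof.
apply/nondecreasing_seqP => n.
rewrite /staged_payoff /stopped_payoff /stopped_before.
case: (tau w) => [k|]; last by rewrite !mulr0.
case: ifPn => [lt_kn|_]; first by rewrite ltnS ltnW.
rewrite mulr0; case: ifP => _.
  exact: expR_ge0.
by rewrite mulr0.
Qed.

Lemma measurable_stopped_payoff (tau : Omega -> option nat) :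
  stopping_time F tau ->
  measurable_fun [set: Omega] (stopped_payoff X g G tau).
Proof.
move=> tauF.
apply: (measurable_fun_cvg (h := fun n => staged tau n (fun=> 0%R))).
  by move=> n; exact: measurable_staged_payoff.
by move=> w _; exact: staged_payoff_cvg.
Qed.

Lemma stopped_payoff_ge0 (tau : Omega -> option nat) w :
  (0 <= stopped_payoff X g G tau w)%R.
Proof. by rewrite /stopped_payoff; case: (tau w) => // k; exact: expR_ge0. Qed.

Lemma stopped_payoff_truncate (tau : Omega -> option nat) n :
  stopped_payoff X g G (truncate tau n) = staged tau n (expR \o G).
Proof.
apply/funext => w.
rewrite /staged_payoff /stopped_payoff /stopped_before /truncate.
case: (tau w) => [k|]; last by rewrite expRD.
rewrite /minn; case: ifP => // _; exact: expRD.
Qed.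

Lemma staged_payoff_one_le (tau : Omega -> option nat) n w :
  tau w != None -> (staged tau n (fun=> 1) w <= stopped_payoff X g G tau w)%R.
Proof.
rewrite /staged_payoff /stopped_payoff /stopped_before.
case: (tau w) => // k _; case: ltnP => // le_nk.
rewrite mulr1 ler_expR -[leLHS]addr0; apply: lerD => //.
rewrite -(subnKC le_nk) big_split_ord /= lerDl; exact: sumr_ge0.
Qed.

(** The linear bound [exp t >= 1 + t] already diverges, which is all that the
    finiteness of the contact time requires. *)
Lemma running_factor_ge (c : R) n w : (forall x, (c <= g x)%R) ->
  (1 + c *+ n <= expR (\sum_(i < n) g (X i w)))%R.
Proof.
move=> gc; apply: le_trans (expR_ge1Dx _); rewrite lerD2l.
rewrite -[n in leLHS]card_ord -sumr_const; exact: ler_sum.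
Qed.

(** * First hitting times *)

Lemma first_hitP (D : nat -> E -> bool) n w :
  stopped_by (first_hit X D) n w <-> exists2 k, (k <= n)%N & D k (X k w).
Proof.
rewrite /stopped_by /= /first_hit; case: pselect => [hit|nohit] /=.
  case: ex_minnP => m Dm minm; split=> [le_mn|[k le_kn Dk]]; first by exists m.
  exact: leq_trans (minm _ Dk) le_kn.
by split=> // -[k _ Dk]; case: nohit; exists k.
Qed.

Lemma first_hit_Some (D : nat -> E -> bool) n w :
  first_hit X D w = Some n -> D n (X n w).
Proof.
by rewrite /first_hit; case: pselect => // hit [<-]; case: ex_minnP.
Qed.

Lemma first_hit_stopping (D : nat -> E -> bool) :
  (forall n, measurable [set x | D n x]) -> stopping_time F (first_hit X D).
Proof.
move=> mD n; apply/(filtrationP F_filtration).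
rewrite (_ : stopped_by _ _ =
  \bigcup_(k in `I_n.+1) X k @^-1` [set x | D k x]).
  apply: (@bigcup_measurable _ (g_sigma_algebraType (F n))) => k.
  rewrite /= ltnS => le_kn; apply/(filtrationP F_filtration).
  exact: (process_preimage F_filtration X_markov le_kn (mD k)).
apply/seteqP; split=> w.
  by move=> /first_hitP[k le_kn Dk]; exists k.
by move=> [k le_kn Dk]; apply/first_hitP; exists k.
Qed.

Lemma first_hit_stops_in (D : nat -> E -> bool) n :
  stops_in X (first_hit X D) [set x | D n x] n.
Proof.
move=> w; split=> [/first_hit_Some //|nst Dn]; apply: nst.
by apply/first_hitP; exists n.
Qed.

Lemma measurable_contact_set h : admissible G h ->
  measurable [set y | h y == expR (G y)].
Proof.
move=> [mh _]; rewrite -[X in measurable X]setTI.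
rewrite (_ : _ `&` _ =
  setT `&` (fun y => h y - expR (G y))%R @^-1` [set 0%R]).
  have mf : measurable_fun [set: E] (fun y => h y - expR (G y))%R.
    by apply: measurable_funB => //; exact: measurableT_comp.
  by apply: mf => //; exact: measurable_set1.
by congr (_ `&` _); apply/seteqP; split => y /=; rewrite -subr_eq0 => /eqP.
Qed.

(** * Costs of stopping times against the iterates *)

Hypothesis E_set1 : forall x : E, measurable [set x].

Lemma staged_payoff0 (tau : Omega -> option nat) h x : admissible G h ->
  'E_(P x)[staged tau 0 h] = (h x)%:E.
Proof.
move=> Ah; have [mh _] := Ah.
rewrite (_ : staged tau 0 h = h \o X 0%N); last first.
  apply/funext => w.
  rewrite /staged_payoff /stopped_before big_ord0 expR0 mul1r.
  by case: (tau w).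
rewrite expectationE.
have -> : \int[P x]_w ((h \o X 0%N) w)%:E = \int[P x]_w (cst (h x)%:E w).
  apply: ge0_ae_eq_integral => //.
  - exact: measurable_next.
  - by move=> w _; rewrite lee_fin (admissible_ge0 _ Ah).
  - by move=> w _; rewrite lee_fin (admissible_ge0 _ Ah).
  - have mA : measurable (X 0%N @^-1` [set x]).
      by rewrite -[X in measurable X]setTI; exact: mX.
    have [_ P1 _ _] := X_markov.
    have PC : P x (~` (X 0%N @^-1` [set x])) = 0.
      rewrite probability_setC// [X in 1 - X](_ : _ = 1); last exact: P1.
      by rewrite subee.
    exists (~` (X 0%N @^-1` [set x])); split => //; first exact: measurableC.
    by move=> w /= nE Xw; apply: nE => _; rewrite Xw.
by rewrite integral_cst// -[RHS]mule1 -(probability_setT (P x)).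
Qed.

(** Almost sure finiteness of [tau] is essential: on [{tau = oo}] the payoff is [0]
    by convention, while the staged payoffs with reward [1] are at least [1]. *)
Lemma iter_one_le_payoff (tau : Omega -> option nat) n x :
  finite_stopping_times F P x tau ->
  (iter n S (fun=> 1%R) x)%:E <= 'E_(P x)[stopped_payoff X g G tau].
Proof.
move=> [tauF tau_fin]; have A1 := admissible_iter n admissible_one.
rewrite -(staged_payoff0 tau x A1).
apply: le_trans (staged_payoff_iter_le 0 n x tauF admissible_one) _.
rewrite add0n !expectationE; apply: ae_ge0_le_integral => //.
- by move=> w _; rewrite lee_fin; exact: staged_payoff_ge0.
- by apply/measurable_EFinP; exact: measurable_staged_payoff.
- by move=> w _; rewrite lee_fin; exact: stopped_payoff_ge0.
- by apply/measurable_EFinP; exact: measurable_stopped_payoff.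
- apply: filterS tau_fin => w tauw _; rewrite lee_fin.
  exact: staged_payoff_one_le.
Qed.

Lemma iter_expG_le_payoff (tau : Omega -> option nat) n x :
  stopping_time F tau ->
  (iter n S (expR \o G) x)%:E <=
  'E_(P x)[stopped_payoff X g G (truncate tau n)].
Proof.
move=> tauF; rewrite stopped_payoff_truncate.
rewrite -(staged_payoff0 tau x (admissible_iter n admissible_expG)).
exact: staged_payoff_iter_le admissible_expG.
Qed.

(** The optimal time stops when the value with the remaining horizon meets the
    obstacle [e^G].  It is at most [n], since no step remains at date [n] and the
    iterate is [e^G] itself; truncating it later changes nothing, so its costs
    are eventually constant and their lower limit is this common value. *)
Lemma finite_horizon_optimal n x : exists2 tau,
  finite_stopping_times F P x tau &
  forall m, (n <= m)%N ->
    'E_(P x)[stopped_payoff X g G (truncate tau m)] =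
    (iter n S (expR \o G) x)%:E.
Proof.
pose D k y := iter (n - k) S (expR \o G) y == expR (G y).
have An := admissible_iter n admissible_expG.
have stop_n w : stopped_by (first_hit X D) n w.
  by apply/first_hitP; exists n => //; rewrite /D subnn.
have tauF : stopping_time F (first_hit X D).
  by apply: first_hit_stopping => k; apply: measurable_contact_set;
    apply: admissible_iter; exact: admissible_expG.
exists (first_hit X D).
  split=> //; apply: aeW => w.
  by have := stop_n w; rewrite /stopped_by /=; case: first_hit.
move=> m le_nm.
have -> : truncate (first_hit X D) m = truncate (first_hit X D) n.
  apply/funext => w; have := stop_n w; rewrite /stopped_by /truncate /=.
  case: first_hit => // k le_kn; congr Some.
  by rewrite !(minn_idPl _)// (leq_trans le_kn).
rewrite stopped_payoff_truncate -(staged_payoff0 (first_hit X D) x An).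
apply/esym/staged_payoff_iter_eq => // [|k _]; first exact: admissible_expG.
have -> : [set y | iter (n - k) S (expR \o G) y = expR (G y)] =
    [set y | D k y].
  by apply/seteqP; split => y /= /eqP.
exact: first_hit_stops_in.
Qed.

Definition contact_time (v : E -> R) : Omega -> option nat :=
  first_hit X (fun _ y => v y == expR (G y)).

Lemma contact_time_stopping v : admissible G v ->
  stopping_time F (contact_time v).
Proof.
by move=> Av; apply: first_hit_stopping => _; exact: measurable_contact_set.
Qed.

(** The contact set of every iterate of a fixed point is the same, so one
    stationary rule is optimal at all dates and horizons. *)
Lemma staged_payoff_contact v n x : admissible G v -> S v = v ->
  'E_(P x)[staged (contact_time v) n v] = (v x)%:E.
Proof.
move=> Av Sv; have tauF := contact_time_stopping Av.
rewrite -(staged_payoff0 (contact_time v) x Av).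
have iterv k : iter k S v = v by elim: k => //= k ->.
have := @staged_payoff_iter_eq (contact_time v) 0 n v x tauF Av.
rewrite iterv => -> // k _; rewrite iterv.
have -> : [set y | v y = expR (G y)] = [set y | v y == expR (G y)].
  by apply/seteqP; split => y /= /eqP.
exact: first_hit_stops_in.
Qed.

(** Where the contact time is infinite the staged payoff at date [n] is at least
    [1 + c n], while its mean stays equal to [v x]; so that event has
    probability at most [v x / (1 + c n)] for every [n]. *)
Lemma contact_time_finite (c : R) v x :
  (0 < c)%R -> (forall y, (c <= g y)%R) -> admissible G v -> S v = v ->
  {ae P x, forall w, contact_time v w != None}.
Proof.
move=> c0 gc Av Sv; have tauF := contact_time_stopping Av.
have [mv v1] := Av; pose N := ~` \bigcup_n stopped_by (contact_time v) n.
have mA n : measurable (stopped_by (contact_time v) n).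
  exact: filtration_measurable (tauF n).
have mN : measurable N by apply/measurableC/bigcup_measurable.
exists N; split => //; last first.
  move=> w /= tauw [n _ stw]; apply: tauw.
  by move: stw; rewrite /stopped_by /=; case: contact_time.
have bound n : (1 + c *+ n)%:E * P x N <= (v x)%:E.
  rewrite -(staged_payoff_contact n x Av Sv) expectationE -integral_cst//.
  apply: (@le_trans _ _
    (\int[P x]_(w in N) (staged (contact_time v) n v w)%:E)).
    apply: ge0_le_integral => //.
    - by move=> w _; rewrite lee_fin addr_ge0// mulrn_wge0// ltW.
    - exact/measurable_funTS/measurable_EFinP/measurable_staged_payoff.
    - move=> w nst; rewrite lee_fin /staged_payoff ifN; last first.
        apply/negP => st; apply: nst; exists n => //; apply/stopped_beforeP.
        by move: st; rewrite /stopped_before; case: contact_time => // k /ltnW.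
      apply: (le_trans (running_factor_ge n w gc)).
      rewrite ler_peMr ?expR_ge0//.
      by have /andP[] := v1 (X n w).
  apply: ge0_subset_integral => //.
    exact/measurable_EFinP/measurable_staged_payoff.
  move=> w _; rewrite lee_fin; apply: staged_payoff_ge0 => y.
  exact: admissible_ge0 Av.
have PN_fin : P x N \is a fin_num by exact: fin_num_measure.
apply/eqP; rewrite eq_le measure_ge0 andbT -(fineK PN_fin) lee_fin leNgt.
apply/negP => p0.
pose p := fine (P x N); pose n := Num.truncn (v x / (c * p))%R.
have := bound n.+1; rewrite -(fineK PN_fin) -EFinM lee_fin -/p leNgt.
apply/negP; rewrite negbK.
have cp0 : (0 < c * p)%R by rewrite mulr_gt0.
have : (v x / (c * p) < n.+1%:R)%R by exact: truncnS_gt.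
rewrite ltr_pdivrMr// => /lt_le_trans; apply.
by rewrite mulrDl mul1r -[(c *+ _)%R]mulr_natl -mulrA lerDr ltW.
Qed.

Lemma contact_time_cost v x : admissible G v -> S v = v ->
  'E_(P x)[stopped_payoff X g G (contact_time v)] <= (v x)%:E.
Proof.
move=> Av Sv; have tauF := contact_time_stopping Av; have [mv _] := Av.
pose Y n w := (staged (contact_time v) n (fun=> 0%R) w)%:E.
have mY n : measurable_fun [set: Omega] (Y n).
  by apply/measurable_EFinP; exact: measurable_staged_payoff.
have Y0 n w : [set: Omega] w -> 0 <= Y n w.
  by move=> _; rewrite lee_fin staged_payoff_ge0.
have Ynd w : [set: Omega] w -> nondecreasing_seq (fun n => Y n w).
  by move=> _ m n le_mn; rewrite lee_fin; exact: staged_payoff_homo.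
have mono := @cvg_monotone_convergence _ _ _ (P x) _ measurableT _ mY Y0 Ynd.
rewrite expectationE.
have -> : \int[P x]_w (stopped_payoff X g G (contact_time v) w)%:E =
    \int[P x]_w limn (fun n => Y n w).
  apply: eq_integral => w _; apply/esym/cvg_lim => //.
  by apply/cvg_EFin; [near=> n|exact: staged_payoff_cvg].
rewrite -(cvg_lim _ mono)//; apply: lime_le.
  by apply/cvg_ex; eexists; exact: mono.
near=> n; rewrite -(staged_payoff_contact n x Av Sv) expectationE.
apply: ge0_le_integral => //.
- by move=> w _; exact: Y0.
- by apply/measurable_EFinP; exact: measurable_staged_payoff.
- move=> w _; rewrite lee_fin /staged_payoff; case: ifP => // _.
  by rewrite mulr0 mulr_ge0 ?expR_ge0// (admissible_ge0 _ Av).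
Unshelve. all: by end_near. Qed.

(** * The Bellman iterates and their limits *)

Lemma expR_bellman_iterate (w0 : E -> R) n : admissible G (expR \o w0) ->
  expR \o bellman_iterate X P g G w0 n = iter n S (expR \o w0).
Proof.
move=> A0; elim: n => // n IH; rewrite iterS -IH; apply/funext => x /=.
rewrite lnK// posrE; apply: lt_le_trans ltr01 _.
have An : admissible G (expR \o bellman_iterate X P g G w0 n).
  by rewrite IH; exact: admissible_iter.
by have [_ /(_ x)/andP[]] := admissible_bellman An.
Qed.

Lemma iter_bellman_le h k n x : admissible G h -> admissible G k ->
  (forall y, (h y <= k y)%R) -> (iter n S h x <= iter n S k x)%R.
Proof.
move=> Ah Ak hk; elim: n x => //= n IH x.
by apply: bellman_op_homo => //; exact: admissible_iter.
Qed.

Lemma expR_comp0 : expR \o (fun=> 0%R) = (fun=> 1%R) :> (E -> R).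
Proof. by apply/funext => y /=; rewrite expR0. Qed.

Lemma iter_one_homo n x :
  (iter n S (fun=> 1) x <= iter n.+1 S (fun=> 1) x)%R.
Proof.
have A1 := admissible_one; rewrite iterSr; apply: iter_bellman_le => //.
  exact: admissible_bellman.
by move=> y; have [_ /(_ y)/andP[]] := admissible_bellman A1.
Qed.

Lemma iter_expG_homo n x :
  (iter n.+1 S (expR \o G) x <= iter n S (expR \o G) x)%R.
Proof.
have AG := admissible_expG; rewrite iterSr; apply: iter_bellman_le => //.
  exact: admissible_bellman.
by move=> y; exact: bellman_op_leG.
Qed.

Lemma bellman_iterate_limit (w0 w : E -> R) : admissible G (expR \o w0) ->
  (forall x, bellman_iterate X P g G w0 n x @[n --> \oo] --> w x) ->
  admissible G (expR \o w) /\ S (expR \o w) = expR \o w.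
Proof.
move=> A0 w_lim; pose hs n := iter n S (expR \o w0).
have An n : admissible G (hs n) by exact: admissible_iter.
have hs_lim x : hs n x @[n --> \oo] --> expR (w x).
  have -> : (fun n => hs n x) =
      (fun n => expR (bellman_iterate X P g G w0 n x)).
    by apply/funext => n; rewrite /hs -expR_bellman_iterate.
  exact: (continuous_cvg _ (@continuous_expR R (w x)) (w_lim x)).
have Aw : admissible G (expR \o w).
  split.
    apply: (measurable_fun_cvg (h := hs)) => [n|x _]; last exact: hs_lim.
    by case: (An n).
  move=> x /=; have cv : cvgn (fun n => hs n x).
    by apply/cvg_ex; eexists; exact: hs_lim.
  rewrite -(cvg_lim _ (hs_lim x))//; apply/andP; split.
    by apply: limr_ge => //; near=> n; have [_ /(_ x)/andP[]] := An n.
  by apply: limr_le => //; near=> n; have [_ /(_ x)/andP[]] := An n.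
split=> //; apply/funext => x.
have Shs : hs n.+1 x @[n --> \oo] --> S (expR \o w) x by exact: bellman_op_cvg.
have hsS : hs n.+1 x @[n --> \oo] --> expR (w x).
  by rewrite (cvg_shiftS (fun n => hs n x)); exact: hs_lim.
by rewrite -(cvg_lim _ Shs)// (cvg_lim _ hsS).
Unshelve. all: by end_near. Qed.

Lemma expR_w_lower n x : expR (w_lower X P g G n x) = iter n S (fun=> 1%R) x.
Proof.
have A0 : admissible G (expR \o (fun=> 0%R)).
  by rewrite expR_comp0; exact: admissible_one.
by have := congr1 (@^~ x) (expR_bellman_iterate n A0); rewrite expR_comp0.
Qed.

Lemma expR_w_upper n x : expR (w_upper X P g G n x) = iter n S (expR \o G) x.
Proof.
by have := congr1 (@^~ x) (expR_bellman_iterate n admissible_expG).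
Qed.

Lemma w_lower_homo x : nondecreasing_seq (fun n => w_lower X P g G n x).
Proof.
apply/nondecreasing_seqP => n; rewrite -ler_expR !expR_w_lower.
exact: iter_one_homo.
Qed.

Lemma w_upper_homo x : nonincreasing_seq (fun n => w_upper X P g G n x).
Proof.
apply/nonincreasing_seqP => n; rewrite -ler_expR !expR_w_upper.
exact: iter_expG_homo.
Qed.

Lemma w_lower_cvg x : cvgn (fun n => w_lower X P g G n x).
Proof.
apply: nondecreasing_is_cvgn; first exact: w_lower_homo.
exists (G x) => _ [n _ <-]; rewrite -ler_expR expR_w_lower.
by have [_ /(_ x)/andP[]] := admissible_iter n admissible_one.
Qed.

Lemma w_upper_cvg x : cvgn (fun n => w_upper X P g G n x).
Proof.
apply: nonincreasing_is_cvgn; first exact: w_upper_homo.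
exists 0%R => _ [n _ <-]; rewrite -ler_expR expR_w_upper expR0.
by have [_ /(_ x)/andP[]] := admissible_iter n admissible_expG.
Qed.

Lemma log_cost_ge (tau : Omega -> option nat) x (r : R) :
  (expR r)%:E <= 'E_(P x)[stopped_payoff X g G tau] ->
  r%:E <= log_cost X P g G tau x.
Proof.
rewrite /log_cost => le_r.
rewrite -(expeRK r%:E) lee_lne// in_itv /= leey andbT.
  by rewrite lee_fin expR_ge0.
by apply: le_trans le_r; rewrite lee_fin expR_ge0.
Qed.

Lemma log_cost_le (tau : Omega -> option nat) x (r : R) :
  'E_(P x)[stopped_payoff X g G tau] <= (expR r)%:E ->
  log_cost X P g G tau x <= r%:E.
Proof.
rewrite /log_cost => le_r.
rewrite -(expeRK r%:E) lee_lne// in_itv /= leey andbT.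
  rewrite expectationE; apply: integral_ge0 => w _; rewrite lee_fin.
  exact: stopped_payoff_ge0.
by rewrite lee_fin expR_ge0.
Qed.

(** * Identification of the two values *)

Lemma value_uE (c : R) (w : E -> R) x : (0 < c)%R -> (forall y, (c <= g y)%R) ->
  (forall y, w_lower X P g G n y @[n --> \oo] --> w y) ->
  value_u F X P g G x = (w x)%:E.
Proof.
move=> c0 gc w_lim.
have A0 : admissible G (expR \o (fun=> 0%R)).
  by rewrite expR_comp0; exact: admissible_one.
have [Aw Sw] := bellman_iterate_limit A0 w_lim.
apply/eqP; rewrite eq_le; apply/andP; split.
  apply: ge_ereal_inf; eexists; last first.
    by apply: log_cost_le; exact: contact_time_cost Aw Sw.
  exists (contact_time (expR \o w)) => //; split.
    exact: contact_time_stopping.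
  exact: contact_time_finite c0 gc Aw Sw.
apply/ereal_infP => _ [tau tauT <-].
have cvE : (w_lower X P g G n x)%:E @[n --> \oo] --> (w x)%:E.
  by apply/cvg_EFin; [near=> n|exact: w_lim].
rewrite -(cvg_lim _ cvE)//; apply: lime_le.
  by apply/cvg_ex; eexists; exact: cvE.
near=> n; apply: log_cost_ge.
rewrite expR_w_lower; exact: iter_one_le_payoff.
Unshelve. all: by end_near. Qed.

Lemma value_wE (w : E -> R) x :
  (forall n, (w x <= w_upper X P g G n x)%R) ->
  w_upper X P g G n x @[n --> \oo] --> w x ->
  value_w F X P g G x = (w x)%:E.
Proof.
move=> w_le w_lim.
apply/eqP; rewrite eq_le; apply/andP; split.
  have cvE : (w_upper X P g G n x)%:E @[n --> \oo] --> (w x)%:E.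
    by apply/cvg_EFin; [near=> n|exact: w_lim].
  rewrite -(cvg_lim _ cvE)//; apply: lime_ge.
    by apply/cvg_ex; eexists; exact: cvE.
  near=> n; have [tau tauT tauE] := finite_horizon_optimal n x.
  apply: ge_ereal_inf; eexists; first by exists tau.
  suff /cvg_limn_einf_sup[-> _] : log_cost X P g G (truncate tau m) x
    @[m --> \oo] --> (w_upper X P g G n x)%:E by [].
  apply: cvg_near_cst; exists n => // m /= le_nm.
  by rewrite /log_cost tauE// -expR_w_upper -[RHS]expeRK.
apply/ereal_infP => _ [tau [tauF _] <-]; apply: limn_einf_ge => n.
apply: le_trans (_ : (w_upper X P g G n x)%:E <= _); first by rewrite lee_fin.
by apply: log_cost_ge; rewrite expR_w_upper; exact: iter_expG_le_payoff.
Unshelve. all: by end_near. Qed.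

Lemma bellman_solution_limit (w0 w : E -> R) : admissible G (expR \o w0) ->
  (forall x, bellman_iterate X P g G w0 n x @[n --> \oo] --> w x) ->
  bellman_solution X P g G w.
Proof.
move=> A0 w_lim; have [[mw w_bnd] Sw] := bellman_iterate_limit A0 w_lim.
split.
- have -> : w = @ln R \o (expR \o w) by apply/funext => x /=; rewrite expRK.
  exact: (measurableT_comp (@measurable_ln R)).
- by move=> x; rewrite -ler_expR expR0; have /andP[] := w_bnd x.
- by move=> x; rewrite Sw.
Qed.

(** The exponential of [v] is a fixed point of the monotone operator [S] lying
    between [1] and [e^G], hence between their iterates. *)
Lemma bellman_solution_between v n x : bellman_solution X P g G v ->
  (forall x, (0 <= v x <= G x)%R) ->
  (w_lower X P g G n x <= v x <= w_upper X P g G n x)%R.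
Proof.
move=> [mv _ Sv] v_bnd.
have Av : admissible G (expR \o v).
  split; first exact: (measurableT_comp (@measurable_expR R)).
  by move=> y /=; rewrite -expR0 !ler_expR; exact: v_bnd.
have iterv : iter n S (expR \o v) = expR \o v.
  by elim: n => //= n ->; apply/funext => y; rewrite [RHS]Sv.
rewrite -ler_expR -[X in _ && X]ler_expR expR_w_lower expR_w_upper.
rewrite -[expR (v x)]/((expR \o v) x) -iterv.
apply/andP; split; apply: iter_bellman_le => //.
- exact: admissible_one.
- by move=> y; have [_ /(_ y)/andP[]] := Av.
- exact: admissible_expG.
- by move=> y; have [_ /(_ y)/andP[]] := Av.
Qed.

End Bellman.

Lemma borel_singleton (R : realType) (d : measure_display)
    (E : measurableMetricType d R) (x : E) :
  borel_space E -> measurable [set x].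
Proof.
move=> E_borel; rewrite -(setCK [set x]); apply: measurableC.
have op : open (~` [set x]).
  apply/closed_openC/accessible_closed_set1/hausdorff_accessible.
  exact: metric_hausdorff.
rewrite /borel_space in E_borel; rewrite E_borel; exact: sub_sigma_algebra.
Qed.

Theorem theorem3p3 (R : realType) (d d' : measure_display)
    (E : measurableMetricType d R) (Omega : measurableType d')
    (F : nat -> set (set Omega)) (X : nat -> Omega -> E)
    (P : E -> probability Omega R) (g G : E -> R) (c : R)
    (E_lc : locally_compact [set: E]) (E_sep : separable_space E)
    (E_borel : borel_space E)
    (F_filtration : filtration F) (X_markov : markov_process F X P)
    (g_meas : measurable_fun [set: E] g) (G_meas : measurable_fun [set: E] G)
    (G_ge0 : forall x, (0 <= G x)%R)
    (g_bounded : exists M : R, forall x, (g x <= M)%R)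
    (c_gt0 : (0 < c)%R) (g_ge_c : forall x, (c <= g x)%R)
    (G_integrable : forall x n,
       'E_(P x)[fun omega =>
         \big[Num.max/0%R]_(i < n.+1) expR (G (X i omega))] < +oo) :
  let u := value_u F X P g G in
  let w := value_w F X P g G in
  [/\ (* (1) *)
      forall x, [/\ cvgn (fun n => w_lower X P g G n x),
                    u x = (limn (fun n => w_lower X P g G n x))%:E,
                    cvgn (fun n => w_upper X P g G n x)
                  & w x = (limn (fun n => w_upper X P g G n x))%:E],
      (* (2) *)
      [/\ forall x, u x \is a fin_num, forall x, w x \is a fin_num,
          bellman_solution X P g G (fun x => fine (u x))
        & bellman_solution X P g G (fun x => fine (w x))]
    & (* (3) *)
      forall v : E -> R, bellman_solution X P g G v ->
        (forall x, (0 <= v x <= G x)%R) ->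
        forall x, u x <= (v x)%:E <= w x].
Proof.
move=> u w.
have g_ge0 x : (0 <= g x)%R by exact: le_trans (ltW c_gt0) (g_ge_c x).
have E_set1 (x : E) : measurable [set x] by exact: borel_singleton.
(* The maximum over the dates [0] and [1] dominates [e^(G (X_1))]. *)
have expG_int x : 'E_(P x)[(expR \o G) \o X 1%N] < +oo.
  apply: le_lt_trans (G_integrable x 1%N); rewrite !expectationE.
  have mexp i : measurable_fun [set: Omega] (fun om => expR (G (X i om))).
    apply: (measurableT_comp (@measurable_expR R)).
    exact: (measurableT_comp G_meas
      (process_measurable F_filtration X_markov i)).
  apply: ge0_le_integral => //.
  - by move=> om _; rewrite lee_fin expR_ge0.
  - by apply/measurable_EFinP; exact: mexp.
  - apply/measurable_EFinP; rewrite [X in measurable_fun _ X](_ : _ =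
      fun om => Num.max (expR (G (X 0%N om)))
                  (Num.max (expR (G (X 1%N om))) 0%R)).
      by apply: measurable_maxr => //; apply: measurable_maxr.
    by apply/funext => om; rewrite !big_ord_recl big_ord0.
  - by move=> om _; rewrite lee_fin !big_ord_recl /= !le_max lexx orbT.
pose lo x := limn (fun n => w_lower X P g G n x).
pose up x := limn (fun n => w_upper X P g G n x).
have lo_cvg x : w_lower X P g G n x @[n --> \oo] --> lo x.
  exact: (w_lower_cvg F_filtration X_markov).
have up_cvg x : w_upper X P g G n x @[n --> \oo] --> up x.
  exact: (w_upper_cvg F_filtration X_markov).
have up_le n x : (up x <= w_upper X P g G n x)%R.
  apply: nonincreasing_cvgn_ge; last exact: up_cvg.
  exact: (w_upper_homo F_filtration X_markov).
have uE x : u x = (lo x)%:E.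
  exact: (value_uE F_filtration X_markov _ _ _ _ _ _ _ c_gt0).
have wE x : w x = (up x)%:E.
  exact: (value_wE F_filtration X_markov).
have fine_u : (fun x => fine (u x)) = lo by apply/funext => x; rewrite uE.
have fine_w : (fun x => fine (w x)) = up by apply/funext => x; rewrite wE.
split.
- by move=> x; split.
- split; rewrite ?fine_u ?fine_w.
  + by move=> x; rewrite uE.
  + by move=> x; rewrite wE.
  + apply: (bellman_solution_limit F_filtration X_markov _ _ _ _ _ _
      lo_cvg) => //.
    by rewrite expR_comp0; exact: admissible_one.
  + apply: (bellman_solution_limit F_filtration X_markov _ _ _ _ _ _
      up_cvg) => //.
    exact: admissible_expG.
- move=> v v_sol v_bnd x; rewrite uE wE !lee_fin.
  have btw n := bellman_solution_between F_filtration X_markov g_meas G_meas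
    g_ge0 G_ge0 n x v_sol v_bnd.
  apply/andP; split.
    apply: limr_le; first exact: lo_cvg.
    by near=> n; have /andP[] := btw n.
  apply: limr_ge; first exact: up_cvg.
  by near=> n; have /andP[] := btw n.
Unshelve. all: by end_near. Qed.
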